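(* Let $(W,S)$ be a right-angled Coxeter system and let $\mathcal{H}$ be a generic Hecke algebra of type $(W,S)$ over a commutative ring $R$. For every conjugacy class $\mathcal{O}\subseteq W$, the map $\varphi_{\mathcal{O}}=\Sigma_{\mathcal{O}}\circ\Phi\colon\mathcal{H}\to R$ is a trace on $\mathcal{H}$. If, for a conjugacy class $\mathcal{U}$ of $W$, $T_{\mathcal{U}}$ denotes the element $T_w+[\mathcal{H},\mathcal{H}]$ of the cocentre of $\mathcal{H}$ for every element $w$ of minimal length in $\mathcal{U}$, then $\varphi_{\mathcal{O}}(T_{\mathcal{U}})=\delta_{\mathcal{O},\mathcal{U}}$ for all conjugacy classes $\mathcal{O},\mathcal{U}$. Moreover, if $R=\mathbb{C}$, the assignment $(c_{\mathcal{O}})_{\mathcal{O}}\mapsto\sum_{\mathcal{O}}c_{\mathcal{O}}\varphi_{\mathcal{O}}$ defines an isomorphism between the space of complex sequences on the set of conjugacy classes of $W$ and the space of tracial functionals on $\mathcal{H}$.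
   Context: A Coxeter system $(W,S)$ ($S$ finite) is right-angled if $\mathrm{ord}(st)\in\{1,2,\infty\}$ for all $s,t\in S$; $|w|$ is word length with respect to $S$. For elements $(a_s)_{s\in S},(b_s)_{s\in S}$ of $R$, the generic Hecke algebra of type $(W,S)$ over $R$ is the unital $R$-algebra that is free as an $R$-module with basis $(T_w)_{w\in W}$ and multiplication determined by, for $s\in S$, $w\in W$: $T_sT_w=T_{sw}$ if $|sw|>|w|$ and $T_sT_w=a_sT_w+b_sT_{sw}$ if $|sw|<|w|$. A trace (tracial functional) is an $R$-linear map $\tau\colon\mathcal{H}\to R$ with $\tau(ab)=\tau(ba)$; it factors through the cocentre $\mathcal{H}/[\mathcal{H},\mathcal{H}]$, where $[\mathcal{H},\mathcal{H}]$ is spanned by the $ab-ba$. The class $T_w+[\mathcal{H},\mathcal{H}]$ is the same for all $w$ of minimal length in a given conjugacy class. Fix a total order $\leq_S$ on $S$. The linear map $\Phi_0\colon\mathcal{H}\to\mathcal{H}$ is defined by $\Phi_0(T_w)=T_w$ if $w$ is of minimal length in its conjugacy class, and $\Phi_0(T_w)=T_{sws}T_s^2$ otherwise, where $s\in S$ is $\leq_S$-minimal with $|sws|<|w|$ (such $s$ exists). The linear map $\Phi$ is $\Phi(T_w)=\lim_n\Phi_0^{\circ n}(T_w)$; the sequence is eventually constant. The linear map $\Sigma_{\mathcal{O}}\colon\mathcal{H}\to R$ is given by $\Sigma_{\mathcal{O}}(T_w)=1$ if $w\in\mathcal{O}$ and $w$ is of minimal length in $\mathcal{O}$, and $\Sigma_{\mathcal{O}}(T_w)=0$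 otherwise. The sum $\sum_{\mathcal{O}}c_{\mathcal{O}}\varphi_{\mathcal{O}}$ is taken pointwise. *)

(* Defs.v *)
From HB Require Import structures.
From mathcomp Require Import all_boot all_order all_algebra finmap.
From mathcomp Require Import boolp classical_sets functions cardinality fsbigop.
From mathcomp Require Import reals complex.

Set Implicit Arguments.
Unset Strict Implicit.
Unset Printing Implicit Defensive.

Import GRing.Theory.
Local Open Scope classical_set_scope.
Local Open Scope ring_scope.

Section CoxeterSystems.
Variable W : groupType.

(* ord(x) = n < oo; ord(x) = oo is expressed by the absence of such an n. *)
Definition has_order (G : groupType) (x : G) (n : nat) : Prop :=
  [/\ (0 < n)%N, (x ^+ n = 1)%g
    & forall m, (0 < m < n)%N -> (x ^+ m <> 1)%g].

Variable S : {fset W}.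

Definition word_prod (u : seq S) : W := (\prod_(s <- u) val s)%g.

(* Bourbaki's definition: S is a generating set of involutions, and W is
   presented by the relations (s t)^(ord (s t)) = 1, ord (s t) < oo, which is
   expressed by the universal property of the presentation. Inverses are not
   needed in the words because the elements of S are involutions. *)
Definition coxeter_system : Prop :=
  [/\ forall s : S, has_order (val s) 2,
      forall w : W, exists u : seq S, w = word_prod u
    & forall (G : groupType) (f : S -> G),
        (forall (s t : S) n, has_order (val s * val t)%g n ->
           ((f s * f t) ^+ n = 1)%g) ->
        exists g : W -> G,
          {morph g : x y / (x * y)%g} /\ forall s : S, g (val s) = f s].

Definition right_angled : Prop :=
  forall (s t : S) n, has_order (val s * val t)%g n -> n = 1%N \/ n = 2%N.

Definition total_order (leS : rel S) : Prop :=
  [/\ total leS, antisymmetric leS & transitive leS].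

Definition len (w : W) : nat :=
  xget 0%N [set n | (exists2 u : seq S, size u = n & w = word_prod u) /\
                    forall u : seq S, w = word_prod u -> (n <= size u)%N].

Definition conj_class (w : W) : set W := [set (w ^ g)%g | g in setT].

Definition conj_classes : set (set W) := range conj_class.

Definition minlen (O : set W) (w : W) : Prop :=
  O w /\ forall x, O x -> (len w <= len x)%N.

Definition shortens (w : W) (s : S) : bool :=
  (len (val s * w * val s)%g < len w)%N.

End CoxeterSystems.

Arguments conj_classes : clear implicits.

Section Bases.
Variables (R : comNzRingType) (I : choiceType) (M : lmodType R) (T : I -> M).

Definition lincomb (c : {fsfun I -> R with 0}) : M :=
  \sum_(i <- finsupp c) c i *: T i.

Definition is_basis : Prop :=
  forall x : M, exists! c : {fsfun I -> R with 0}, x = lincomb c.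

Definition basis_coord (x : M) : {fsfun I -> R with 0} :=
  xget [fsfun] [set c | x = lincomb c].

(* If T is a basis: the linear map sending T i to f i. *)
Definition lin_ext (N : lmodType R) (f : I -> N) (x : M) : N :=
  \sum_(i <- finsupp (basis_coord x)) basis_coord x i *: f i.

End Bases.

Section Hecke.
Variables (W : groupType) (S : {fset W}) (R : comNzRingType).

(* H is the generic Hecke algebra of type (W, S) with parameters a and b, and
   T is its standard basis. *)
Record is_hecke (a b : S -> R) (H : algType R) (T : W -> H) : Prop := {
  hecke_basis : is_basis T;
  hecke_one : T 1%g = 1;
  hecke_mul_up : forall (s : S) (w : W),
    (len S w < len S (val s * w)%g)%N -> T (val s) * T w = T (val s * w)%g;
  hecke_mul_down : forall (s : S) (w : W),
    (len S (val s * w)%g < len S w)%N ->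
    T (val s) * T w = a s *: T w + b s *: T (val s * w)%g }.

Variables (leS : rel S) (H : algType R) (T : W -> H).

(* The None branch is never reached in a right-angled Coxeter system. *)
Definition Phi0_basis (w : W) : H :=
  if `[< minlen S (conj_class w) w >] then T w
  else if [pick s : S | shortens w s & [forall t : S, shortens w t ==> leS s t]]
       is Some s then T (val s * w * val s)%g * T (val s) ^+ 2
  else T w.

Definition Phi0 : H -> H := lin_ext T Phi0_basis.

(* The eventual value of the sequence n |-> Phi0^n (T w). *)
Definition Phi_basis (w : W) : H :=
  xget 0 [set h | exists N, forall n, (N <= n)%N -> iter n Phi0 (T w) = h].

Definition Phi : H -> H := lin_ext T Phi_basis.

Definition Sigma (O : set W) : H -> R :=
  @lin_ext R W H T R^o (fun w => if `[< minlen S O w >] then 1 else 0).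

Definition phi (O : conj_classes W) : H -> R := Sigma (val O) \o Phi.

Definition is_trace (tau : H -> R) : Prop :=
  scalar tau /\ forall x y : H, tau (x * y) = tau (y * x).

(* [H, H], and the class h + [H, H] in the cocentre as a subset of H. *)
Definition commutators : set H :=
  [set h | exists n (c : 'I_n -> R) (x y : 'I_n -> H),
     h = \sum_i c i *: (x i * y i - y i * x i)].

Definition cocentre_class (h : H) : set H :=
  [set x | commutators (x - h)].

(* The finitely supported sum \sum_(_ \in _) is 0 when infinitely many terms
   are nonzero. *)
Definition phi_sum (c : conj_classes W -> R^o) : H -> R^o :=
  fun h => \sum_(O \in [set: conj_classes W]) c O * phi O h.

End Hecke.

(* Main.v *)
Require Import Defs.
From HB Require Import structures.
From mathcomp Require Import all_boot all_order all_algebra finmap.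
From mathcomp Require Import boolp classical_sets functions cardinality fsbigop.
From mathcomp Require Import reals complex.
From mathcomp Require Import zify ring.

Import GRing.Theory.
Local Open Scope classical_set_scope.
Local Open Scope ring_scope.

(** The values of a trace on the standard basis are constrained by two
relations. If [s] shortens [w], that is [|sws| = |w| - 2], then
[T_w = T_s T_sws T_s], whence the shortening rule
[f(w) = a_s f(sw) + b_s f(sws)] for [f(w) = tau(T_w)]; and [f(sws) = f(w)]
whenever [|sws| = |w|]. Conversely, a linear form satisfying both relations is
a trace ([rules_trace]): it suffices to compare [T_s T_w] with [T_w T_s], and
each of the four cases given by the descents of [w] is an instance of one or
both relations.

The heart of the proof is a confluence argument. Suppose that the shortening
rule holds at each [w] for one shortening generator only, and that
[f(sws) = f(w)] is only known for those [w] that no generator shortens. Then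
the rule holds for every shortening generator ([rule_every_shortening]) and
[f(sws) = f(w)] holds whenever [|sws| = |w|] ([rule_shift_invariant]). In a
right-angled group two generators that both shorten [w] commute, and each still
shortens what the other one produces, so that applying the two rules in either
order expresses [f(w)] by the same four values. Likewise, a generator
that shortens [w] commutes with the [s] of a length-preserving conjugation and
shortens [sws] as well.

The same argument, with [a = 0] and [b = 1], settles the combinatorics of
conjugacy classes: take for [f] the indicator of a property that is invariant
under length-preserving conjugations by generators, evaluated at the result of
shortening as long as possible. Then [f] is a class function, so the property
is transported between any two conjugate elements that no generator shortens
([cyc_reduced_conj]). Applied to the property of having a given length, this
shows that elements that no generator shortens are exactly those of minimal
length in their conjugacy class ([minlen_cyc_reduced]); applied to the property
that [tau(T_w)] has a given value, it shows that a trace is constant on the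
elements of minimal length in a class ([trace_minlen]).

The function [phi_O(T_w)] satisfies the shortening rule for the generator
chosen by [Phi_0], and is the indicator of [O] on elements of minimal length;
by confluence it is a trace. Since a trace is determined by its values on the
elements of minimal length, and these values form an arbitrary function on
the set of conjugacy classes, the [phi_O] form a basis of the traces in the
sense of infinite sums.

The facts about descents come from the reflection cocycle: a map from [W] to
the sets of elements of [W], with [N(xy) = N(x) + x N(y) x^-1] and
[N(s) = {s}]. It exists by the universal property of the
presentation, and yields the exchange condition ([cocycle_shortens]). *)

(** * The reflection cocycle *)

(** The semidirect product of [W] with the subsets of [W] under symmetric
difference, [W] acting by conjugation: a homomorphism [x |-> (x, N x)] into it
is a cocycle [N]. *)
Definition conj_xor (W : groupType) : Type := (W * (W -> bool))%type.

Section ConjXorGroup.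
Variable W : groupType.
Local Open Scope group_scope.

HB.instance Definition _ := gen_eqMixin (conj_xor W).
HB.instance Definition _ := gen_choiceMixin (conj_xor W).

Implicit Types p q : conj_xor W.

Definition cx_one : conj_xor W := (1, fun=> false).
Definition cx_inv p : conj_xor W := (p.1^-1, fun r => p.2 (r ^ p.1^-1)).
Definition cx_mul p q : conj_xor W :=
  (p.1 * q.1, fun r => p.2 r (+) q.2 (r ^ p.1)).

Lemma cx_mulA : associative cx_mul.
Proof.
move=> p q r; congr pair; rewrite /= ?mulgA //.
by apply/funext => x; rewrite /= conjgM addbA.
Qed.

Lemma cx_mul1g : left_id cx_one cx_mul.
Proof.
by case=> x A; congr pair; rewrite /= ?mul1g //; apply/funext => r; rewrite /= conjg1.
Qed.

Lemma cx_mulg1 : right_id cx_one cx_mul.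
Proof.
by case=> x A; congr pair; rewrite /= ?mulg1 //; apply/funext => r; rewrite /= addbF.
Qed.

Lemma cx_mulVg : left_inverse cx_one cx_inv cx_mul.
Proof.
by case=> x A; congr pair; rewrite /= ?mulVg //; apply/funext => r; rewrite /= addbb.
Qed.

Lemma cx_mulgV : right_inverse cx_one cx_inv cx_mul.
Proof.
case=> x A; congr pair; rewrite /= ?mulgV //.
by apply/funext => r; rewrite /= conjgK addbb.
Qed.

HB.instance Definition _ :=
  isGroup.Build (conj_xor W) cx_mulA cx_mul1g cx_mulg1 cx_mulVg cx_mulgV.

End ConjXorGroup.

Section RightAngled.
Set Implicit Arguments.
Unset Strict Implicit.
Unset Printing Implicit Defensive.
Variables (W : groupType) (S : {fset W}).
Hypotheses (cox : coxeter_system S) (ra : right_angled S).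
Local Open Scope group_scope.

Implicit Types (s t : S) (w x y : W) (u v : seq S).

Lemma genK s : val s * val s = 1.
Proof. by have [ord2 _ _] := cox; have [_] := ord2 s; rewrite expg2. Qed.

Lemma genV s : (val s)^-1 = val s.
Proof. by apply/mulg1_eq/genK. Qed.

Lemma genKl s w : val s * (val s * w) = w.
Proof. by rewrite mulgA genK mul1g. Qed.

Lemma genKr s w : w * val s * val s = w.
Proof. by rewrite -mulgA genK mulg1. Qed.

(** The finite orders of the [st] being 1 or 2, the presentation only involves
the relations [s^2 = 1] and [st = ts]. *)
Lemma right_angled_hom (G : groupType) (f : S -> G) :
  (forall s, f s * f s = 1) ->
  (forall s t, commute (val s) (val t) -> commute (f s) (f t)) ->
  exists g : W -> G, {morph g : x y / x * y} /\ forall s, g (val s) = f s.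
Proof.
move=> f2 fC; have [_ _ univ] := cox; apply: univ => s t n ord_st.
have [n1|n2] := ra ord_st; subst n; have [_ st1 _] := ord_st.
  rewrite expg1 in st1; have -> : s = t.
    by apply: val_inj; rewrite /= -[LHS]genV; apply: mulg1_eq.
  by rewrite expg1 f2.
have/fC fst : commute (val s) (val t).
  rewrite /commute -[LHS]invgK; rewrite expg2 in st1.
  by rewrite (mulg1_eq st1) invgM !genV.
by rewrite expg2 {1}fst mulgA -(mulgA (f t)) f2 mulg1 f2.
Qed.

(** [N w] is the set of the reflections [r] such that [|rw| < |w|]; on a word
[s_1 ... s_n] it collects, modulo 2, the reflections
[s_1 ... s_(i-1) s_i s_(i-1) ... s_1]. *)
Definition reflection_cocycle (N : W -> W -> bool) :=
  (forall x y r, N (x * y) r = N x r (+) N y (r ^ x)) /\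
  (forall s r, N (val s) r = (r == val s)).

Lemma ex_reflection_cocycle : exists N, reflection_cocycle N.
Proof.
pose f s : conj_xor W := (val s, fun r => r == val s).
have conj_eq s r : (r ^ val s == val s) = (r == val s).
  rewrite -(inj_eq (conjg_inj (val s)) r); congr eq_op.
  by rewrite conjgE mulKg.
have [||g [gM gs]] := @right_angled_hom (conj_xor W) f.
- move=> s; congr pair; rewrite /= ?genK //.
  by apply/funext => r; rewrite /= conj_eq addbb.
- move=> s t Cst; congr pair => //; apply/funext => r /=.
  have Jst s' t' : commute (val s') (val t') ->
      (r ^ val s' == val t') = (r == val t').
    move=> C; rewrite -(inj_eq (conjg_inj (val s')) r); congr eq_op.
    by rewrite conjgE -C mulgA mulVg mul1g.
  by rewrite (Jst _ _ Cst) (Jst _ _ (commute_sym Cst)) addbC.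
have g1 w : (g w).1 = w.
  have [_ /(_ w) [u ->] _] := cox; rewrite /word_prod.
  elim: u => [|s u IH]; last by rewrite big_cons gM /= IH gs.
  rewrite big_nil; apply: (@mulgI _ (g 1).1); rewrite mulg1.
  by rewrite -[LHS]/((g 1 * g 1).1) -gM mulg1.
exists (fun w => (g w).2); split => [x y r|s r].
  by rewrite gM /= g1.
by rewrite gs.
Qed.

(** The parity of the number of letters [s] in a word only depends on its
product, because the relations preserve it. *)
Lemma ex_letter_parity : exists p : W -> W -> bool,
  (forall x y r, p (x * y) r = p x r (+) p y r) /\
  (forall s r, p (val s) r = (r == val s)).
Proof.
pose f s : conj_xor W := (1, fun r => r == val s).
have [||g [gM gs]] := @right_angled_hom (conj_xor W) f.
- move=> s; congr pair; rewrite /= ?mulg1 //.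
  by apply/funext => r; rewrite /= conjg1 addbb.
- move=> s t _; congr pair; apply/funext => r; rewrite /= !conjg1; exact: addbC.
have g1 w : (g w).1 = 1.
  have [_ /(_ w) [u ->] _] := cox; rewrite /word_prod.
  elim: u => [|s u IH]; last by rewrite big_cons gM /= IH gs mulg1.
  rewrite big_nil; apply: (@mulgI _ (g 1).1); rewrite mulg1.
  by rewrite -[LHS]/((g 1 * g 1).1) -gM mulg1.
exists (fun w => (g w).2); split => [x y r|s r].
  by rewrite gM /= g1 conjg1.
by rewrite gs.
Qed.

Lemma conj_gen_eq s t w : val s * w = w * val t -> s = t.
Proof.
move=> sw; have [p [pM ps]] := ex_letter_parity.
have := congr1 (p^~ (val s)) sw; rewrite !pM !ps eqxx addbC => /addbI/esym/eqP.
exact: val_inj.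
Qed.

(** * Word length and the exchange condition *)

Lemma len_spec w : (exists2 u : seq S, size u = len S w & w = word_prod u) /\
  forall u : seq S, w = word_prod u -> (len S w <= size u)%N.
Proof.
suff ex_n : exists n, (exists2 u : seq S, size u = n & w = word_prod u) /\
    forall u : seq S, w = word_prod u -> (n <= size u)%N.
  by rewrite /len; case: xgetP => [n _ //|noP]; case: ex_n => n /noP.
have [_ /(_ w) [u wu] _] := cox.
pose Q n := `[< exists2 u : seq S, size u = n & w = word_prod u >].
have exQ : exists n, Q n by exists (size u); apply/asboolP; exists u.
case: (ex_minnP exQ) => n /asboolP Qn minn; exists n; split=> // v wv.
by apply: minn; apply/asboolP; exists v.
Qed.

Lemma len_word u : (len S (word_prod u) <= size u)%N.
Proof. by have [_] := len_spec (word_prod u); apply. Qed.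

Lemma len1 : len S 1 = 0%N.
Proof. by have := len_word ([::] : seq S); rewrite /word_prod big_nil leqn0 => /eqP. Qed.

Lemma len_eq0 w : len S w = 0%N -> w = 1.
Proof.
move=> w0; have [[u + ->] _] := len_spec w; rewrite w0 => /size0nil ->.
by rewrite /word_prod big_nil.
Qed.

Lemma lenV w : len S w^-1 = len S w.
Proof.
suff le x : (len S x^-1 <= len S x)%N by have := le w; have := le w^-1; rewrite invgK; lia.
have [[u <- ->] _] := len_spec x; rewrite -size_rev.
suff -> : (word_prod u)^-1 = word_prod (rev u) by exact: len_word.
rewrite /word_prod; elim: u => [|s u IH]; first by rewrite !big_nil invg1.
by rewrite big_cons invgM IH rev_cons big_rcons /= genV.
Qed.

Lemma len_gen_mul s w : (len S (val s * w) <= (len S w).+1)%N.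
Proof.
have [[u <- ->] _] := len_spec w; have := len_word (s :: u).
by rewrite /word_prod big_cons.
Qed.

Lemma len_mul_gen s w : (len S (w * val s) <= (len S w).+1)%N.
Proof. by rewrite -lenV invgM genV -(lenV w) len_gen_mul. Qed.

Section Cocycle.
Variable N : W -> W -> bool.
Hypothesis cocN : reflection_cocycle N.

Let NM x y r : N (x * y) r = N x r (+) N y (r ^ x).
Proof. by case: cocN. Qed.

Let NS s r : N (val s) r = (r == val s).
Proof. by case: cocN. Qed.

Let N1 r : N 1 r = false.
Proof. by have := NM 1 1 r; rewrite mulg1 conjg1; case: (N 1 r). Qed.

(** Strong exchange: if [N w r] then [r] is one of the reflections collected
along a reduced word of [w], and multiplying by it deletes a letter. *)
Lemma cocycle_shortens w r : N w r -> (len S (r * w) < len S w)%N.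
Proof.
have [[u <- {w}->] _] := len_spec w.
suff H : N (word_prod u) r ->
    exists2 v : seq S, (size v < size u)%N & r * word_prod u = word_prod v.
  by move/H => [v ltvu ->]; apply: leq_ltn_trans ltvu; apply: len_word.
rewrite /word_prod; elim: u r => [|s u IH] r; first by rewrite big_nil N1.
rewrite big_cons NM NS; case: eqP => [-> _|_ /IH[v ltvu Ev]].
  by exists u => //=; rewrite genKl.
exists (s :: v); rewrite //= big_cons -Ev conjgE genV.
by rewrite !mulgA genK mul1g.
Qed.

Lemma cocycle_gen_mul s w : N (val s * w) (val s) = ~~ N w (val s).
Proof. by rewrite NM NS eqxx conjgE mulKg. Qed.

Lemma cocycle_descent s w : N w (val s) = (len S (val s * w) < len S w)%N.
Proof.
apply/idP/idP => [/cocycle_shortens //|]; apply: contraTT => nNw.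
rewrite -leqNgt ltnW // -{1}(genKl s w); apply: cocycle_shortens.
by rewrite cocycle_gen_mul.
Qed.

(** Multiplying on the right by [t] only affects the left descent [s] when the
two products coincide. *)
Lemma cocycle_mul_gen s t w :
  N (w * val t) (val s) = N w (val s) (+) (val s * w == w * val t).
Proof.
rewrite NM NS; congr addb; rewrite -(inj_eq (mulgI w)); congr eq_op.
by rewrite conjgE mulVKg.
Qed.

Lemma cocycle_gen_commute s t w : s != t -> commute (val s) (val t) ->
  N (val t * w) (val s) = N w (val s).
Proof.
move=> neq_st C; rewrite NM NS (inj_eq val_inj) (negbTE neq_st) conjgE C mulKg.
by [].
Qed.

Lemma power_commute s t n : s != t -> (0 < n)%N ->
  (val s * val t) ^+ n = 1 -> commute (val s) (val t).
Proof.
move=> neq_st n_gt0 stn.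
pose Q k := (0 < k)%N && ((val s * val t) ^+ k == 1).
have exQ : exists k, Q k by exists n; rewrite /Q n_gt0; apply/eqP.
case: (ex_minnP exQ) => k /andP[k_gt0 /eqP stk] mink.
have : has_order (val s * val t) k.
  split=> // m /andP[m_gt0 ltmk] stm.
  by have := mink m; rewrite /Q m_gt0 stm eqxx leqNgt ltmk => /(_ isT).
case/ra => k12; subst k.
  rewrite expg1 in stk; case/eqP: neq_st; apply: val_inj => /=.
  by rewrite -[LHS]genV; apply: mulg1_eq.
rewrite expg2 in stk; rewrite /commute -[LHS]invgK.
by rewrite (mulg1_eq stk) invgM !genV.
Qed.

(** * Left descents commute *)

(** The elements of the dihedral group generated by [s] and [t] that have an
alternating expression starting with [s]. *)
Definition alternating s t x :=
  exists k, x = (val s * val t) ^+ k \/ x = (val s * val t) ^+ k * val s.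

Lemma alternating_swap s t k :
  val s * (val t * val s) ^+ k = (val s * val t) ^+ k * val s.
Proof.
elim: k => [|k IH]; first by rewrite mul1g mulg1.
by rewrite expgSr mulgA IH expgSr -!mulgA.
Qed.

Lemma alternating_mul s t x : alternating s t x \/ alternating t s x ->
  alternating s t (val s * x) \/ alternating t s (val s * x).
Proof.
case=> -[k [->|->]].
- case: k => [|k]; first by left; exists 0%N; right; rewrite mulg1 mul1g.
  by right; exists k; right; rewrite expgS !mulgA genK mul1g alternating_swap.
- case: k => [|k]; first by left; exists 0%N; left; rewrite mul1g genK.
  right; exists k.+1; left; rewrite expgS !mulgA genK mul1g.
  by rewrite alternating_swap expgSr -!mulgA.
- by left; exists k; right; rewrite alternating_swap.
- by left; exists k.+1; left; rewrite mulgA alternating_swap expgSr -!mulgA.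
Qed.

Lemma word2_alternating s t (u : seq S) : {subset u <= [:: s; t]} ->
  alternating s t (word_prod u) \/ alternating t s (word_prod u).
Proof.
rewrite /word_prod; elim: u => [|a u IH] sub_u.
  by rewrite big_nil; left; exists 0%N; left.
rewrite big_cons; have/IH {}IH : {subset u <= [:: s; t]}.
  by move=> b bu; apply: sub_u; rewrite inE bu orbT.
have := sub_u a (mem_head _ _); rewrite !inE => /orP[] /eqP ->.
  exact: alternating_mul.
by apply/or_comm/alternating_mul/or_comm.
Qed.

(** An alternating word starting with [s] collects reflections [(st)^i s] only;
if one of them were of the form [(ts)^j t], then [ts] would have finite
order. *)
Lemma cocycle_alternating s t x j : s != t -> ~ commute (val s) (val t) ->
  alternating s t x -> N x ((val t * val s) ^+ j * val t) = false.
Proof.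
move=> neq_st nC; have neq_ts : t != s by rewrite eq_sym.
have nCts : ~ commute (val t) (val s) by move/commute_sym.
suff H k z : (z = 1 \/ z = val s) ->
    N ((val s * val t) ^+ k * z) ((val t * val s) ^+ j * val t) = false.
  by case=> k [->|->]; [rewrite -[_ ^+ k]mulg1|]; apply: H; [left|right].
move=> z1s; elim: k j => [|k IH] j.
  rewrite mul1g; case: z1s => ->; rewrite ?N1 ?NS //; apply/eqP => E.
  apply: nCts; apply: (@power_commute _ _ j.+1) => //.
  by rewrite expgSr mulgA E genK.
rewrite expgS -!mulgA NM NS; case: eqP => [E|_].
  case: nCts; apply: (@power_commute _ _ j.+1) => //.
  by rewrite expgSr mulgA E genK.
rewrite NM NS; case: eqP => [E|_].
  case: nCts; apply: (@power_commute _ _ j.+2) => //.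
  rewrite expgS expgSr -!mulgA; rewrite conjgE genV -!mulgA in E.
  by rewrite E genK.
rewrite -conjgM conjgE invgM !genV.
have -> : val t * val s * ((val t * val s) ^+ j * val t * (val s * val t))
  = (val t * val s) ^+ j.+2 * val t.
  by rewrite expgS expgSr -!mulgA.
by rewrite IH.
Qed.

(** Write [w = u y] with [u] in the subgroup generated by [s] and [t] and [y] of
minimal length in its coset. No reflection of that subgroup lies in [N y], so
[s] and [t] are left descents of [w] if and only if they are left descents of
[u]. If [s] and [t] did not commute, [cocycle_alternating] would exclude one of
them. *)
Lemma left_descents_commute s t w : s != t ->
  N w (val s) -> N w (val t) -> commute (val s) (val t).
Proof.
move=> neq_st Ns Nt; apply: contrapT => nC.
pose Q n := `[< exists u y, [/\ {subset u <= [:: s; t]}, len S y = n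
  & w = word_prod u * y] >].
have exQ : exists n, Q n.
  exists (len S w); apply/asboolP; exists [::], w; split=> //.
  by rewrite /word_prod big_nil mul1g.
case: (ex_minnP exQ) => n /asboolP[u [y [sub_u len_y def_w]]] min_n.
have Ny a : a \in [:: s; t] -> N y (val a ^ word_prod u) = false.
  move=> a_st; apply/negP => /cocycle_shortens; rewrite len_y ltnNge => /negP[].
  apply: min_n; apply/asboolP; exists (a :: u), (val a ^ word_prod u * y).
  split=> // [b|].
    by rewrite inE => /predU1P[->|/sub_u].
  rewrite /word_prod big_cons -/(word_prod u) conjgE.
  by rewrite !mulgA mulgK genK mul1g.
have Nw a : a \in [:: s; t] -> N (word_prod u) (val a) = N w (val a).
  by move=> a_st; rewrite def_w NM Ny // addbF.
case: (word2_alternating sub_u) => alt_u.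
  have := cocycle_alternating 0 neq_st nC alt_u.
  by rewrite mul1g Nw ?Nt // !inE eqxx orbT.
have neq_ts : t != s by rewrite eq_sym.
have nCts : ~ commute (val t) (val s) by move/commute_sym.
have := cocycle_alternating 0 neq_ts nCts alt_u.
by rewrite mul1g Nw ?Ns // !inE eqxx.
Qed.

End Cocycle.

(** * Descents *)

Definition ldesc s w := (len S (val s * w) < len S w)%N.
Definition rdesc s w := (len S (w * val s) < len S w)%N.

Lemma rdescV s w : rdesc s w = ldesc s w^-1.
Proof. by rewrite /rdesc /ldesc -lenV invgM genV -(lenV w). Qed.

Lemma len_gen_mulE s w : len S (val s * w) =
  if ldesc s w then (len S w).-1 else (len S w).+1.
Proof.
have [N cocN] := ex_reflection_cocycle.
have := cocycle_gen_mul cocN s w; rewrite !(cocycle_descent cocN) genKl.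
have := len_gen_mul s w; have := len_gen_mul s (val s * w).
rewrite genKl /ldesc; move: (len S _) (len S w) => m n.
by case E: (m < n)%N => /=; lia.
Qed.

Lemma len_mul_genE s w : len S (w * val s) =
  if rdesc s w then (len S w).-1 else (len S w).+1.
Proof. by rewrite -lenV invgM genV len_gen_mulE rdescV lenV. Qed.

Lemma ldesc_mul_gen s t w : val s * w != w * val t ->
  ldesc s (w * val t) = ldesc s w.
Proof.
move=> ne; have [N cocN] := ex_reflection_cocycle.
by rewrite /ldesc -!(cocycle_descent cocN) cocycle_mul_gen // (negbTE ne) addbF.
Qed.

Lemma rdesc_gen_mul s t w : val t * w != w * val s ->
  rdesc s (val t * w) = rdesc s w.
Proof.
move=> ne; rewrite !rdescV invgM genV ldesc_mul_gen //.
apply: contraNneq ne => E; apply/eqP/invg_inj.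
by rewrite !invgM !genV E.
Qed.

Lemma gen_mul_neq s t w : s != t -> val s * w != w * val t.
Proof. by apply: contraNneq => /conj_gen_eq ->. Qed.

Lemma ldesc_gen_commute s t w : s != t -> commute (val s) (val t) ->
  ldesc s (val t * w) = ldesc s w.
Proof.
move=> ne C; have [N cocN] := ex_reflection_cocycle.
by rewrite /ldesc -!(cocycle_descent cocN) cocycle_gen_commute.
Qed.

Lemma rdesc_commute_gen s t w : s != t -> commute (val s) (val t) ->
  rdesc s (w * val t) = rdesc s w.
Proof. by move=> ne C; rewrite !rdescV invgM genV ldesc_gen_commute. Qed.

Lemma ldesc_commute s t w : s != t -> ldesc s w -> ldesc t w ->
  commute (val s) (val t).
Proof.
move=> ne; have [N cocN] := ex_reflection_cocycle.
rewrite /ldesc -!(cocycle_descent cocN); exact: left_descents_commute.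
Qed.

Lemma rdesc_commute s t w : s != t -> rdesc s w -> rdesc t w ->
  commute (val s) (val t).
Proof. by rewrite !rdescV; apply: ldesc_commute. Qed.

Lemma ldesc_len_gt0 s w : ldesc s w -> (0 < len S w)%N.
Proof. exact: leq_ltn_trans. Qed.

Lemma ex_ldesc w : (0 < len S w)%N -> exists s, ldesc s w.
Proof.
have [[[|s u] len_w def_w] _] := len_spec w; rewrite -len_w // => _; exists s.
by rewrite /ldesc -len_w def_w /word_prod big_cons genKl ltnS len_word.
Qed.

Lemma len_conj_gen s w : ldesc s w != rdesc s w ->
  len S (val s * w * val s) = len S w.
Proof.
move=> neLR; have [E|ne] := eqVneq (val s * w) (w * val s); first by rewrite E genKr.
rewrite len_mul_genE rdesc_gen_mul // len_gen_mulE; move: neLR.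
case Ls: (ldesc s w); case: (rdesc s w) => // _.
by have := ldesc_len_gt0 Ls; lia.
Qed.

(** * Shortening conjugations *)

Lemma shortensE s w :
  shortens w s = [&& ldesc s w, rdesc s w & val s * w != w * val s].
Proof.
rewrite /shortens; have [E|ne] := eqVneq (val s * w) (w * val s).
  by rewrite E genKr ltnn !andbF.
rewrite andbT len_mul_genE rdesc_gen_mul // len_gen_mulE.
case Ls: (ldesc s w) => /=; last by case: rdesc => /=; apply/negbTE; lia.
have := ldesc_len_gt0 Ls; case: rdesc => /=; first by lia.
by move=> w_gt0; apply/negbTE; lia.
Qed.

Lemma len_shortens s w : shortens w s ->
  (len S (val s * w)).+1 = len S w /\ (len S (val s * w * val s)).+2 = len S w.
Proof.
rewrite shortensE => /and3P[Ls Rs ne].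
have := ldesc_len_gt0 Ls; rewrite len_mul_genE rdesc_gen_mul // Rs.
have : (0 < len S (val s * w))%N.
  apply: (@leq_ltn_trans (len S (val s * w * val s))) => //.
  by rewrite -/(rdesc s (val s * w)) rdesc_gen_mul.
by rewrite len_gen_mulE Ls; lia.
Qed.

Lemma shortens_commute s t w : s != t -> shortens w s -> shortens w t ->
  commute (val s) (val t).
Proof.
by rewrite !shortensE => ne /and3P[Ls _ _] /and3P[Lt _ _]; apply: ldesc_commute Lt.
Qed.

Lemma shortens_gen_mul s t w : s != t -> commute (val s) (val t) ->
  shortens (val t * w) s = shortens w s.
Proof.
move=> ne C; rewrite !shortensE ldesc_gen_commute // rdesc_gen_mul; last first.
  by rewrite gen_mul_neq // eq_sym.
by rewrite mulgA C -!mulgA (inj_eq (mulgI _)).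
Qed.

Lemma shortens_mul_gen s t w : s != t -> commute (val s) (val t) ->
  shortens (w * val t) s = shortens w s.
Proof.
move=> ne C; rewrite !shortensE rdesc_commute_gen // ldesc_mul_gen; last first.
  by rewrite gen_mul_neq.
by rewrite -!mulgA -C !mulgA (inj_eq (mulIg _)).
Qed.

(** One of the sides of [w] at which [s] is a descent has [t] as a descent as
well, hence [s] and [t] commute. *)
Lemma shift_shortens s t w : len S (val s * w * val s) = len S w ->
  val s * w != w * val s -> shortens w t ->
  s != t /\ commute (val s) (val t).
Proof.
move=> eq_len ne St; have ne_st : s != t.
  by apply: contraTneq St => <-; rewrite /shortens eq_len ltnn.
split=> //; move: St; rewrite shortensE => /and3P[Lt Rt _].
have := len_mul_genE s (val s * w); rewrite eq_len rdesc_gen_mul // len_gen_mulE.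
case Ls: (ldesc s w); first by move=> _; apply: ldesc_commute Lt.
by case Rs: (rdesc s w); [move=> _; apply: rdesc_commute Rt|lia].
Qed.

(** * Confluence of the shortening rule *)

Definition cyc_reduced w := forall s, ~~ shortens w s.

Definition shortening_rule (R : comNzRingType) (a b : S -> R) (f : W -> R) s w :=
  f w = (a s * f (val s * w)%g + b s * f (val s * w * val s)%g)%R.

Definition shift_invariant (T : Type) (f : W -> T) s w :=
  len S (val s * w * val s) = len S w -> f (val s * w * val s) = f w.

Lemma cyc_reducedPn w : ~ cyc_reduced w -> exists s : S, shortens w s.
Proof. by move/existsNP => [s /negP]; rewrite negbK; exists s. Qed.

Section Recursion.
Variables (R : comNzRingType) (a b : S -> R) (f : W -> R).
Hypothesis f_rule : forall w, ~ cyc_reduced w ->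
  exists2 s : S, shortens w s & shortening_rule a b f s w.
Hypothesis f_shift : forall s w, cyc_reduced w -> shift_invariant f s w.

(** Diamond argument: for commuting [s] and [t], both expansions of [f w] lead
to the values of [f] at [stw], [stws], [stwt] and [stwts]. *)
Lemma rule_every_shortening s w : shortens w s -> shortening_rule a b f s w.
Proof.
have [n le_wn] := ubnP (len S w); elim: n => // n IH in s w le_wn *.
move=> Sw; have [|t Tw rule_t] := @f_rule w; first by move/(_ s); rewrite Sw.
have [->//|ne] := eqVneq s t; have ne' : t != s by rewrite eq_sym.
have C := shortens_commute ne Sw Tw; have C' := commute_sym C.
have [lS lS2] := len_shortens Sw; have [lT lT2] := len_shortens Tw.
rewrite /shortening_rule rule_t.
rewrite (IH s (val t * w)) ?(IH s (val t * w * val t)) ?(IH t (val s * w))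
  ?(IH t (val s * w * val s)) ?shortens_mul_gen ?shortens_gen_mul //; try lia.
have E1 : val s * (val t * w) = val t * (val s * w) by rewrite !mulgA C.
have E2 : val s * (val t * w) * val s = val t * (val s * w * val s).
  by rewrite E1 !mulgA.
have E3 : val s * (val t * w * val t) = val t * (val s * w) * val t.
  by rewrite -E1 !mulgA.
have E4 : val s * (val t * w * val t) * val s = val t * (val s * w * val s) * val t.
  by rewrite E3 -!mulgA C'.
by rewrite E4 E3 E2 E1; ring.
Qed.

(** If [t] shortens [w], it commutes with [s] and shortens [sws]; the two
expansions agree by induction, because conjugation by [s] preserves the lengths
of [tw] and [twt]. *)
Lemma rule_shift_invariant s w : shift_invariant f s w.
Proof.
have [n le_wn] := ubnP (len S w); elim: n => // n IH in s w le_wn *.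
move=> eq_len; have [->|ne] := eqVneq (val s * w) (w * val s).
  by rewrite genKr.
have [|/cyc_reducedPn[t St]] := pselect (cyc_reduced w); first by move/f_shift; apply.
have [ne_st C] := shift_shortens eq_len ne St; have C' := commute_sym C.
have ne_ts : t != s by rewrite eq_sym.
have St' : shortens (val s * w * val s) t.
  by rewrite shortens_mul_gen // shortens_gen_mul.
have [lT lT2] := len_shortens St; have [] := len_shortens St'.
rewrite (rule_every_shortening St) (rule_every_shortening St').
have E : val t * (val s * w * val s) = val s * (val t * w) * val s.
  by rewrite !mulgA C'.
have E2 : val t * (val s * w * val s) * val t = val s * (val t * w * val t) * val s.
  by rewrite E -!mulgA C.
rewrite E2 E => lT' lT2'.
by rewrite (IH s (val t * w)) ?(IH s (val t * w * val t)) //; lia.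
Qed.

End Recursion.

Lemma cyc_reduced_shift s y : cyc_reduced y ->
  len S (val s * y * val s) = len S y -> cyc_reduced (val s * y * val s).
Proof.
move=> red_y eq_len; have [->|ne] := eqVneq (val s * y) (y * val s).
  by rewrite genKr.
move=> t; apply/negP => St; have yE : val s * (val s * y * val s) * val s = y.
  by rewrite !mulgA genK mul1g genKr.
have [||ne_st C] := @shift_shortens s t _ _ _ St.
- by rewrite yE.
- by apply: contraNneq ne; rewrite !mulgA genK mul1g genKr => ->.
have ne_ts : t != s by rewrite eq_sym.
have C' := commute_sym C; move: (red_y t); rewrite -yE.
by rewrite shortens_mul_gen // shortens_gen_mul // St.
Qed.

(** * Conjugation and elements of minimal length *)

Definition shorten_step (w : W) : W :=
  oapp (fun s : S => val s * w * val s) w [pick s : S | shortens w s].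

Lemma shorten_step_id w : cyc_reduced w -> shorten_step w = w.
Proof. by rewrite /shorten_step; case: pickP => // s Sw /(_ s); rewrite Sw. Qed.

Lemma shorten_stepP w : ~ cyc_reduced w ->
  exists2 s : S, shortens w s & shorten_step w = val s * w * val s.
Proof.
move/cyc_reducedPn => [s Sw]; rewrite /shorten_step; case: pickP => [t Tw|/(_ s)].
  by exists t.
by rewrite Sw.
Qed.

(** [|w|] steps suffice, since each one that changes [w] lowers its length. *)
Lemma iter_shorten_step n w : (len S w <= n)%N ->
  iter n shorten_step w = iter (len S w) shorten_step w
  /\ cyc_reduced (iter n shorten_step w).
Proof.
move: w; suff red n' w : (len S w <= n')%N -> cyc_reduced (iter n' shorten_step w).
  move=> w le_wn; split; last exact: red.
  rewrite -(subnK le_wn) iterD; elim: (n - _)%N => // m IH.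
  by rewrite iterS IH shorten_step_id //; apply: red.
elim: n' w => [|n' IH] w le_w.
  by move=> s; rewrite /shortens (eqP (_ : len S w == 0%N)) // -leqn0.
rewrite iterSr; have [rw|nrw] := pselect (cyc_reduced w).
  rewrite shorten_step_id //; elim: n' {IH le_w} => //= m IH.
  by rewrite shorten_step_id.
have [s Sw ->] := shorten_stepP nrw; apply: IH.
by have [_] := len_shortens Sw; lia.
Qed.

(** The confluence of the shortening rule for [a = 0] and [b = 1] makes the
indicator of [P] at the result of shortening a class function. *)
Lemma cyc_reduced_conj (P : W -> Prop) w x :
  (forall s y, len S (val s * y * val s) = len S y -> P y ->
     P (val s * y * val s)) ->
  cyc_reduced w -> cyc_reduced x -> conj_class w x -> P w -> P x.
Proof.
move=> P_shift red_w red_x [h _ def_x] Pw.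
pose f y : int := (`[< P (iter (len S y) shorten_step y) >])%:R%R.
have f_red y : cyc_reduced y -> f y = (`[< P y >])%:R%R.
  move=> red_y; rewrite /f; suff -> : iter (len S y) shorten_step y = y by [].
  by elim: len => //= n ->; apply: shorten_step_id.
have f_rule y : ~ cyc_reduced y ->
    exists2 s : S, shortens y s & shortening_rule (fun=> 0%R) (fun=> 1%R) f s y.
  move=> /shorten_stepP[s Sy def_sy]; exists s => //.
  rewrite /shortening_rule mul0r add0r mul1r /f.
  have [_ len_sy] := len_shortens Sy; rewrite -len_sy iterSr def_sy.
  by rewrite (iter_shorten_step (leqnSn _)).1.
have f_shift s y : cyc_reduced y -> shift_invariant f s y.
  move=> red_y eq_len; rewrite !f_red //; last exact: cyc_reduced_shift.
  congr (nat_of_bool _)%:R%R; apply/asboolP/asboolP => [|Py]; last exact: P_shift.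
  move=> Psy; have := P_shift s (val s * y * val s).
  by rewrite !mulgA genK mul1g genKr eq_len; apply.
have f_conj s y : f (val s * y * val s) = f y.
  have := @rule_shift_invariant int _ _ f f_rule f_shift s y.
  have := @rule_every_shortening int _ _ f f_rule s y.
  have := @rule_every_shortening int _ _ f f_rule s (val s * y * val s).
  rewrite /shortening_rule !mul0r !add0r !mul1r /shortens.
  rewrite !mulgA genK mul1g genKr.
  by case: ltngtP => [_ /(_ isT)->|_ _ /(_ isT)->|eq_len _ _]; last exact.
have f_class y : f (y ^ h) = f y.
  have [_ /(_ h) [u ->] _] := cox; rewrite /word_prod.
  elim: u y => [|s u IH] y; first by rewrite big_nil conjg1.
  by rewrite big_cons conjgM IH conjgE genV mulgA f_conj.
have := f_class w; rewrite def_x (f_red _ red_x) (f_red _ red_w) (asboolT Pw).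
by case: asboolP.
Qed.

(** An element of minimal length in the class is conjugate to [w] and shortened
by no generator either; [cyc_reduced_conj], for the property of having the
length of [w], shows that both have the same length. *)
Lemma minlen_cyc_reduced w : minlen S (conj_class w) w <-> cyc_reduced w.
Proof.
split=> [[_ minw] s|red_w].
  rewrite /shortens -leqNgt; apply: minw; exists (val s) => //.
  by rewrite conjgE genV mulgA.
pose Q n := `[< exists2 y, conj_class w y & len S y = n >].
have exQ : exists n, Q n.
  by exists (len S w); apply/asboolP; exists w => //; exists 1; rewrite ?conjg1.
case: (ex_minnP exQ) => n /asboolP[y wy len_y] min_n.
have min_y z : conj_class w z -> (len S y <= len S z)%N.
  by move=> wz; rewrite len_y; apply: min_n; apply/asboolP; exists z.
have conj_trans z h : conj_class w z -> conj_class w (z ^ h).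
  by case=> k _ <-; exists (k * h) => //; rewrite conjgM.
have red_y : cyc_reduced y.
  move=> s; rewrite /shortens -leqNgt; apply: min_y.
  by have := conj_trans y (val s) wy; rewrite conjgE genV mulgA.
have eq_len : len S y = len S w.
  apply: (cyc_reduced_conj (P := fun z => len S z = len S w)) wy _ => //.
  by move=> s z ->.
split=> [|z wz]; first by exists 1; rewrite ?conjg1.
by rewrite -eq_len; apply: min_y.
Qed.

End RightAngled.

(** * Linear maps on a module with a basis *)

Section FreeModules.
Set Implicit Arguments.
Unset Strict Implicit.
Unset Printing Implicit Defensive.
Variables (R : comNzRingType) (I : choiceType) (M : lmodType R) (T : I -> M).
Implicit Types c d : {fsfun I -> R with 0}.

Lemma linear_props (V V' : lmodType R) (f : V -> V') :
  linear f ->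
  [/\ f 0 = 0, {morph f : x y / x + y} & forall k, {morph f : x / k *: x}].
Proof.
move=> lin; have fD : {morph f : x y / x + y}.
  by move=> x y; rewrite -[x]scale1r lin !scale1r.
have f0 : f 0 = 0 by apply: (addIr (f 0)); rewrite -fD !add0r.
by split=> // k x; rewrite -[k *: x]addr0 lin f0 addr0.
Qed.

Lemma lincomb_fset (N : lmodType R) (f : I -> N) c (A : {fset I}) :
  (finsupp c `<=` A)%fset -> lincomb f c = \sum_(i <- A) c i *: f i.
Proof.
move=> sub_cA; rewrite /lincomb; apply: big_fset_incl => // i _.
by move/fsfun_dflt ->; rewrite scale0r.
Qed.

Lemma lincomb_linear (N : lmodType R) (f : I -> N) k c d :
  lincomb f [fsfun i in (finsupp c `|` finsupp d)%fset => k * c i + d i]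
    = k *: lincomb f c + lincomb f d.
Proof.
set A := (_ `|` _)%fset; set cd := [fsfun _ in _ => _].
have cdE i : cd i = k * c i + d i.
  rewrite fsfunE; case: ifPn => //; rewrite inE negb_or => /andP[].
  by move=> /fsfun_dflt -> /fsfun_dflt ->; rewrite mulr0 addr0.
rewrite (@lincomb_fset _ _ cd A) ?finsupp_sub //.
rewrite (@lincomb_fset _ _ c A) ?fsubsetUl // (@lincomb_fset _ _ d A) ?fsubsetUr //.
rewrite scaler_sumr -big_split; apply: eq_bigr => i _ /=.
by rewrite cdE scalerDl scalerA.
Qed.

Hypothesis basT : is_basis T.

Lemma lincomb_coord x : lincomb T (basis_coord T x) = x.
Proof.
have [c [xc _]] := basT x; rewrite /basis_coord; case: xgetP => [d _ /esym //|].
by move/(_ c).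
Qed.

Lemma lincomb_inj c d : lincomb T c = lincomb T d -> c = d.
Proof. by have [e [_ uniq]] := basT (lincomb T c) => /uniq <-; apply/esym/uniq. Qed.

Lemma lin_ext_linear (N : lmodType R) (f : I -> N) : linear (lin_ext T f).
Proof.
move=> k x y; rewrite /lin_ext -!/(lincomb f _) -lincomb_linear; congr lincomb.
by apply: lincomb_inj; rewrite lincomb_linear !lincomb_coord.
Qed.

Lemma lin_ext_basis (N : lmodType R) (f : I -> N) i : lin_ext T f (T i) = f i.
Proof.
pose d : {fsfun I -> R with 0} := [fsfun j in [fset i]%fset => 1].
have lincomb_d (N' : lmodType R) (g : I -> N') : lincomb g d = g i.
  rewrite (@lincomb_fset _ _ _ [fset i]%fset) ?finsupp_sub // big_seq_fset1.
  by rewrite fsfunE inE eqxx scale1r.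
rewrite /lin_ext -/(lincomb f _) (_ : basis_coord T (T i) = d) ?lincomb_d //.
by apply: lincomb_inj; rewrite lincomb_coord lincomb_d.
Qed.

Lemma basis_ind (P : M -> Prop) : (forall i, P (T i)) -> P 0 ->
  (forall k x y, P x -> P y -> P (k *: x + y)) -> forall x, P x.
Proof.
move=> PT P0 Plin x; rewrite -(lincomb_coord x) /lincomb.
by elim/big_rec: _ => // i y _; apply: Plin.
Qed.

Lemma linear_basis_eq (N : lmodType R) (f g : M -> N) : linear f -> linear g ->
  (forall i, f (T i) = g (T i)) -> f =1 g.
Proof.
move=> lin_f lin_g eq_fg; elim/basis_ind => // [|k x y Ex Ey].
  by have [-> _ _] := linear_props lin_f; have [-> _ _] := linear_props lin_g.
by rewrite lin_f lin_g Ex Ey.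
Qed.

End FreeModules.

(** * Products in the Hecke algebra *)

Section Hecke.
Set Implicit Arguments.
Unset Strict Implicit.
Unset Printing Implicit Defensive.
Variables (W : groupType) (S : {fset W}).
Hypotheses (cox : coxeter_system S) (ra : right_angled S).
Variables (R : comNzRingType) (a b : S -> R) (H : algType R) (T : W -> H).
Hypothesis heckeH : is_hecke a b T.
Implicit Types (s t : S) (w x y : W).

Let basT : is_basis T := hecke_basis heckeH.

Lemma hecke_gen_mul s w : T (val s) * T w =
  if ldesc s w then a s *: T w + b s *: T (val s * w)%g else T (val s * w)%g.
Proof.
case: ifPn => [/(hecke_mul_down heckeH) //|nL].
by apply: (hecke_mul_up heckeH); rewrite (len_gen_mulE cox ra) (negbTE nL).
Qed.

Lemma hecke_gen_sqr s : T (val s) * T (val s) = a s *: T (val s) + b s *: 1.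
Proof.
rewrite hecke_gen_mul ifT ?(genK cox) ?(hecke_one heckeH) //.
rewrite /ldesc (genK cox) (len1 cox) -(mulg1 (val s)) (len_gen_mulE cox ra).
by rewrite /ldesc (len1 cox) ltn0.
Qed.

(** Multiplication on the right is derived from multiplication on the left by
splitting off the first letter of a reduced word. *)
Lemma hecke_mul_gen_up s w : ~~ rdesc s w -> T w * T (val s) = T (w * val s)%g.
Proof.
have [n le_wn] := ubnP (len S w); elim: n => // n IH in w le_wn *.
move=> nR; have [/(len_eq0 cox) ->|] := posnP (len S w).
  by rewrite mul1g (hecke_one heckeH) mul1r.
case/(ex_ldesc cox) => t Lt.
have [w' def_w'] : exists w', w' = (val t * w)%g by exists (val t * w)%g.
have def_w : w = (val t * w')%g by rewrite def_w' (genKl cox).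
have := len_mul_genE cox ra s w; rewrite (negbTE nR) => len_ws.
have := len_gen_mul cox t (w' * val s)%g; rewrite mulgA -def_w len_ws.
have := len_mul_gen cox s w'; move: Lt; rewrite /ldesc -def_w' => Lt le1 le2.
have nLt : ~~ ldesc t w' by rewrite /ldesc -def_w -leqNgt; lia.
have nLt' : ~~ ldesc t (w' * val s)%g.
  by rewrite /ldesc mulgA -def_w -leqNgt len_ws; lia.
have nR' : ~~ rdesc s w' by rewrite /rdesc -leqNgt; lia.
have := hecke_gen_mul t w'; rewrite (negbTE nLt) -def_w => <-.
rewrite -mulrA IH //; last by lia.
by rewrite hecke_gen_mul (negbTE nLt') mulgA -def_w.
Qed.

Lemma hecke_mul_gen s w : T w * T (val s) =
  if rdesc s w then a s *: T w + b s *: T (w * val s)%g else T (w * val s)%g.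
Proof.
case: ifPn => [Rs|/hecke_mul_gen_up //].
have := @hecke_mul_gen_up s (w * val s)%g; rewrite /rdesc (genKr cox) -leqNgt.
move=> /(_ (ltnW Rs)) def_Tw; rewrite -{1}def_Tw -mulrA hecke_gen_sqr.
by rewrite mulrDr -!scalerAr def_Tw mulr1.
Qed.

Lemma hecke_shortens s w : shortens w s ->
  T w = T (val s) * (T (val s * w * val s)%g * T (val s)).
Proof.
move=> Sw; have [lS lS2] := len_shortens cox ra Sw.
rewrite hecke_mul_gen ifN ?(genKr cox) ?hecke_gen_mul ?ifN ?(genKl cox) //.
  by rewrite /ldesc (genKl cox); lia.
by rewrite /rdesc (genKr cox); lia.
Qed.

Lemma hecke_shortened_sqr s w : shortens w s ->
  T (val s * w * val s)%g * T (val s) ^+ 2 =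
    a s *: T (val s * w)%g + b s *: T (val s * w * val s)%g.
Proof.
move=> Sw; have [lS lS2] := len_shortens cox ra Sw.
rewrite expr2 hecke_gen_sqr mulrDr -!scalerAr mulr1 hecke_mul_gen ifN ?(genKr cox) //.
by rewrite /rdesc (genKr cox); lia.
Qed.

(** * Traces as solutions of the shortening rule *)

Lemma scalar_props (tau : H -> R) : scalar tau ->
  [/\ tau 0 = 0, {morph tau : x y / x + y}
    & forall k, {morph tau : x / k *: x >-> k * x}].
Proof. exact: (@linear_props R H R^o tau). Qed.

Lemma trace_shortening_rule (tau : H -> R) s w : is_trace tau ->
  shortens w s -> shortening_rule a b (tau \o T) s w.
Proof.
case=> /scalar_props[_ tauD tauZ] tauC Sw.
rewrite /shortening_rule /= (hecke_shortens Sw) tauC.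
by rewrite -mulrA -expr2 (hecke_shortened_sqr Sw) tauD !tauZ.
Qed.

Lemma trace_shift_invariant (tau : H -> R) s w : is_trace tau ->
  shift_invariant (S := S) (tau \o T) s w.
Proof.
case=> _ tauC eq_len /=.
have [->|ne] := eqVneq (val s * w)%g (w * val s)%g; first by rewrite (genKr cox).
have := len_mul_genE cox ra s (val s * w)%g.
rewrite eq_len (rdesc_gen_mul cox) // (len_gen_mulE cox ra).
case Ls: (ldesc s w); case Rs: (rdesc s w) => len_w.
- by have := ldesc_len_gt0 Ls; lia.
- have := tauC (T (val s)) (T (val s * w)%g).
  rewrite hecke_gen_mul hecke_mul_gen (rdesc_gen_mul cox) // Rs ifN ?(genKl cox) //.
  by rewrite /ldesc (genKl cox) -leqNgt ltnW.
- have := tauC (T (val s)) (T (w * val s)%g).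
  rewrite hecke_gen_mul hecke_mul_gen (ldesc_mul_gen cox) // Ls ifN ?(genKr cox) ?mulgA //.
  by rewrite /rdesc (genKr cox) -leqNgt ltnW.
- by lia.
Qed.

(** Since the [T_s] generate the algebra, only [T_s T_w] and [T_w T_s] have to
be compared. *)
Lemma rules_trace (tau : H -> R) : scalar tau ->
  (forall s w, shortens w s -> shortening_rule a b (tau \o T) s w) ->
  (forall s w, shift_invariant (S := S) (tau \o T) s w) ->
  is_trace tau.
Proof.
move=> lin rule shift; split=> //; have [tau0 tauD tauZ] := scalar_props lin.
have tau_gen s w : tau (T (val s) * T w) = tau (T w * T (val s)).
  have shift' := shift s (val s * w)%g; rewrite /shift_invariant /= (genKl cox) in shift'.
  have rule_sw := rule s (val s * w)%g.
  have rule_ws := rule s (w * val s)%g.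
  rewrite /shortening_rule /shortens /= (genKl cox) in rule_sw.
  rewrite /shortening_rule /shortens mulgA /= (genKr cox) in rule_ws.
  have := shift s w; rewrite /shift_invariant /=.
  move: rule_sw rule_ws shift'; rewrite hecke_gen_mul hecke_mul_gen.
  have := len_mul_genE cox ra s w; have := len_gen_mulE cox ra s w.
  have := @len_conj_gen _ _ cox ra s w.
  (* If [s] is a descent of [w] on both sides or on neither, then [sw] and [ws]
     are conjugate by [s] and of equal length; otherwise [s] shortens the longer
     one of them. *)
  case: ifPn => Ls; case: ifPn => Rs len_conj lenL lenR.
  - by move=> _ _ shift_sw _; rewrite !tauD !tauZ shift_sw // lenL lenR.
  - have eq_len : len S (val s * w * val s)%g = len S w.
      exact: len_conj.
    move=> _ rule_ws _ shift_w; rewrite rule_ws ?shift_w ?eq_len ?tauD ?tauZ //.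
    by rewrite lenL lenR; lia.
  - have eq_len : len S (val s * w * val s)%g = len S w.
      exact: len_conj.
    move=> rule_sw _ _ shift_w; rewrite rule_sw ?shift_w ?eq_len ?tauD ?tauZ //.
    by rewrite lenL lenR; lia.
  - by move=> _ _ ->; rewrite // lenL lenR.
have tau_gen' s (y : H) : tau (T (val s) * y) = tau (y * T (val s)).
  elim/(basis_ind basT): y => [//||k x y Ex Ey].
    by rewrite mulr0 mul0r.
  by rewrite mulrDr mulrDl -scalerAr -scalerAl !tauD !tauZ Ex Ey.
have tau_basis w (y : H) : tau (T w * y) = tau (y * T w).
  have [n le_wn] := ubnP (len S w); elim: n => // n IH in w le_wn y *.
  have [/(len_eq0 cox) ->|] := posnP (len S w).
    by rewrite (hecke_one heckeH) mul1r mulr1.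
  case/(ex_ldesc cox) => s Ls.
  have def_Tw : T w = T (val s) * T (val s * w)%g.
    rewrite hecke_gen_mul ifN ?(genKl cox) //.
    by rewrite /ldesc (genKl cox) -leqNgt ltnW.
  rewrite def_Tw -mulrA tau_gen' -mulrA IH ?mulrA //.
  by move: Ls; rewrite /ldesc; lia.
move=> x y; elim/(basis_ind basT): x => [//||k x1 x2 E1 E2].
  by rewrite mulr0 mul0r.
by rewrite mulrDr mulrDl -scalerAr -scalerAl !tauD !tauZ E1 E2.
Qed.

(** * Computation of Phi *)

Variable leS : rel S.
Hypothesis leS_order : total_order leS.

Lemma total_order_min (r : seq S) : r != [::] ->
  exists2 s, s \in r & {in r, forall t, leS s t}.
Proof.
have [tot _ trans] := leS_order.
have refl s : leS s s by have := tot s s; rewrite orbb.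
elim: r => // s [|s' r] IH _.
  by exists s; rewrite ?mem_head // => t; rewrite inE => /eqP ->.
have [m m_r min_m] := IH isT; have [le_sm|le_ms] := orP (tot s m).
  exists s; first exact: mem_head.
  by move=> t; rewrite inE => /predU1P[-> //|/min_m]; apply: trans.
exists m; first by rewrite inE m_r orbT.
by move=> t; rewrite inE => /predU1P[-> //|/min_m].
Qed.

Lemma Phi0_basis_reduced w : cyc_reduced S w -> Phi0_basis leS T w = T w.
Proof.
move=> red_w; rewrite /Phi0_basis ifT //.
exact/asboolP/(minlen_cyc_reduced cox ra).
Qed.

Lemma Phi0_basis_shortens w : ~ cyc_reduced S w -> exists2 s : S, shortens w s &
  Phi0_basis leS T w = a s *: T (val s * w)%g + b s *: T (val s * w * val s)%g.
Proof.
move=> nred; rewrite /Phi0_basis ifF; last first.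
  by apply/asboolPn => /(minlen_cyc_reduced cox ra).
case: pickP => [s /andP[Sw _]|no_s]; first by exists s; rewrite ?hecke_shortened_sqr.
have [s0 Sw0] := cyc_reducedPn nred.
pose shortening : pred S := fun s => shortens w s.
have [|s] := @total_order_min (enum shortening).
  apply/eqP => enum0; have : s0 \in enum shortening by rewrite mem_enum.
  by rewrite enum0.
rewrite mem_enum => Sw min_s; have {}Sw : shortens w s by [].
have := no_s s; rewrite /= Sw => /negbT/negP[].
by apply/forallP => t; apply/implyP => Tw; apply: min_s; rewrite mem_enum.
Qed.

Lemma Phi0_linear : linear (Phi0 leS T).
Proof. exact: lin_ext_linear. Qed.

Lemma iter_Phi0_linear n : linear (iter n (Phi0 leS T)).
Proof.
by elim: n => [|n IH] k x y //=; rewrite IH Phi0_linear.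
Qed.

Lemma iter_Phi0_shortens s w n :
  Phi0_basis leS T w = a s *: T (val s * w)%g + b s *: T (val s * w * val s)%g ->
  iter n.+1 (Phi0 leS T) (T w) = a s *: iter n (Phi0 leS T) (T (val s * w)%g)
    + b s *: iter n (Phi0 leS T) (T (val s * w * val s)%g).
Proof.
move=> def_Phi0; have [_ itD itZ] := linear_props (iter_Phi0_linear n).
by rewrite iterSr /Phi0 (lin_ext_basis basT) def_Phi0 itD !itZ.
Qed.

Lemma Phi_basis_iter h w N :
  (forall n, (N <= n)%N -> iter n (Phi0 leS T) (T w) = h) ->
  Phi_basis leS T w = h.
Proof.
move=> lim_h; rewrite /Phi_basis; case: xgetP => [h' _ [N' lim_h']|no_h].
  by rewrite -(lim_h _ (leq_maxl N N')) (lim_h' _ (leq_maxr N N')).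
by case: (no_h h); exists N.
Qed.

Lemma Phi_basis_eventually w : exists N, forall n, (N <= n)%N ->
  iter n (Phi0 leS T) (T w) = Phi_basis leS T w.
Proof.
suff [h [N lim_h]] : exists h N, forall n, (N <= n)%N ->
    iter n (Phi0 leS T) (T w) = h.
  by exists N => n le_Nn; rewrite lim_h // (Phi_basis_iter lim_h).
have [m le_wm] := ubnP (len S w); elim: m => // m IH in w le_wm *.
have [red_w|nred] := pselect (cyc_reduced S w).
  exists (T w), 0%N; elim=> //= n -> // _.
  by rewrite /Phi0 (lin_ext_basis basT) Phi0_basis_reduced.
have [s Sw def_Phi0] := Phi0_basis_shortens nred.
have [lS lS2] := len_shortens cox ra Sw.
have [|h1 [N1 lim1]] := IH (val s * w)%g; first by rewrite -lS in le_wm; lia.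
have [|h2 [N2 lim2]] := IH (val s * w * val s)%g; first by rewrite -lS2 in le_wm; lia.
exists (a s *: h1 + b s *: h2), (maxn N1 N2).+1 => -[//|n].
rewrite ltnS geq_max => /andP[le1 le2].
by rewrite (iter_Phi0_shortens _ def_Phi0) lim1 ?lim2.
Qed.

Lemma Phi_basis_reduced w : cyc_reduced S w -> Phi_basis leS T w = T w.
Proof.
move=> red_w; apply: (@Phi_basis_iter _ _ 0) => n _; elim: n => //= n ->.
by rewrite /Phi0 (lin_ext_basis basT) Phi0_basis_reduced.
Qed.

Lemma Phi_basis_shortens w : ~ cyc_reduced S w -> exists2 s : S, shortens w s &
  Phi_basis leS T w = a s *: Phi_basis leS T (val s * w)%g
                    + b s *: Phi_basis leS T (val s * w * val s)%g.
Proof.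
move=> nred; have [s Sw def_Phi0] := Phi0_basis_shortens nred; exists s => //.
have [N1 lim1] := Phi_basis_eventually (val s * w)%g.
have [N2 lim2] := Phi_basis_eventually (val s * w * val s)%g.
apply: (@Phi_basis_iter _ _ (maxn N1 N2).+1) => -[//|n].
rewrite ltnS geq_max => /andP[le1 le2].
by rewrite (iter_Phi0_shortens _ def_Phi0) lim1 ?lim2.
Qed.

(** * The traces attached to conjugacy classes *)

Implicit Types O U : conj_classes W.

Lemma phi_scalar O : scalar (phi leS T O).
Proof.
move=> k x y; rewrite /phi /= /Phi /Sigma.
by rewrite (lin_ext_linear basT) (@lin_ext_linear _ _ _ _ basT R^o).
Qed.

Lemma phi_basis O w : phi leS T O (T w) = Sigma S T (val O) (Phi_basis leS T w).
Proof. by rewrite /phi /= /Phi (lin_ext_basis basT). Qed.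

Lemma phi_reduced O w : cyc_reduced S w ->
  phi leS T O (T w) = (`[< minlen S (val O) w >])%:R.
Proof.
move=> red_w; rewrite phi_basis Phi_basis_reduced // /Sigma (lin_ext_basis basT).
by case: ifP.
Qed.

(** The generator is the one chosen by [Phi0]; that every other one would do is
the content of the confluence argument. *)
Lemma phi_rule O w : ~ cyc_reduced S w -> exists2 s, shortens w s &
  shortening_rule a b (phi leS T O \o T) s w.
Proof.
case/Phi_basis_shortens => s Sw def_Phi; exists s => //.
rewrite /shortening_rule /= !phi_basis def_Phi.
have [_ sD sZ] := @linear_props _ _ R^o _ (@lin_ext_linear _ _ _ _ basT R^o
  (fun w => if `[< minlen S (val O) w >] then 1 else 0)).
by rewrite /Sigma sD !sZ.
Qed.

Lemma conj_classP O : exists w, val O = conj_class w.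
Proof. by have := valP O; rewrite inE => -[w _ <-]; exists w. Qed.

Lemma conj_classJ O w x : val O w -> val O (w ^ x)%g.
Proof.
by have [y ->] := conj_classP O => -[h _ <-]; exists (h * x)%g; rewrite ?conjgM.
Qed.

Lemma conj_class_gen O s w : val O w -> val O (val s * w * val s)%g.
Proof. by move/(@conj_classJ _ _ (val s)); rewrite conjgE (genV cox) mulgA. Qed.

Lemma minlen_conj_gen O s w : len S (val s * w * val s)%g = len S w ->
  minlen S (val O) w -> minlen S (val O) (val s * w * val s)%g.
Proof.
by move=> eq_len [Ow min_w]; split=> [|x /min_w]; rewrite ?eq_len //; apply: conj_class_gen.
Qed.

Lemma phi_shift O s w : cyc_reduced S w ->
  shift_invariant (S := S) (phi leS T O \o T) s w.
Proof.
move=> red_w eq_len /=; rewrite !phi_reduced //; last first.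
  exact: (cyc_reduced_shift cox ra).
congr (nat_of_bool _)%:R; apply/asboolP/asboolP; last exact: minlen_conj_gen.
move=> /(@minlen_conj_gen O s); rewrite !mulgA (genK cox) mul1g (genKr cox) eq_len.
exact.
Qed.

Lemma phi_trace O : is_trace (phi leS T O).
Proof.
apply: rules_trace; first exact: phi_scalar.
  exact: (rule_every_shortening cox ra (@phi_rule O)).
exact: (rule_shift_invariant cox ra (@phi_rule O) (@phi_shift O)).
Qed.

Lemma conj_class_eq O U w : val O w -> val U w -> O = U.
Proof.
have conj_classE (V : conj_classes W) : val V w -> val V = conj_class w.
  have [y ->] := conj_classP V => -[h _ <-]; apply/seteqP; split=> z [k _ <-].
    by exists (h^-1 * k)%g; rewrite // conjgM conjgK.
  by exists (h * k)%g; rewrite // conjgM.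
by move=> /conj_classE EO /conj_classE EU; apply: val_inj; rewrite EO EU.
Qed.

Lemma minlen_reduced O w : minlen S (val O) w -> cyc_reduced S w.
Proof.
case=> Ow min_w; apply/(minlen_cyc_reduced cox ra); split=> [|x [h _ <-]].
  by exists 1%g; rewrite ?conjg1.
exact/min_w/conj_classJ.
Qed.

Lemma reduced_minlen w : cyc_reduced S w -> exists O, minlen S (val O) w.
Proof.
move/(minlen_cyc_reduced cox ra) => min_w.
have Cw : conj_class w \in conj_classes W by rewrite inE; exists w.
by exists (SigSub Cw).
Qed.

Lemma phi_minlen O U w : minlen S (val U) w -> phi leS T O (T w) = (O == U)%:R.
Proof.
move=> min_w; rewrite phi_reduced; last exact: minlen_reduced min_w.
congr (nat_of_bool _)%:R; apply/asboolP/eqP => [[Ow _]|-> //].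
by case: min_w => Uw _; apply: conj_class_eq Uw.
Qed.

Lemma trace_cocentre (tau : H -> R) (h x : H) : is_trace tau ->
  cocentre_class h x -> tau x = tau h.
Proof.
case=> /scalar_props[tau0 tauD tauZ] tauC [n [c [y [z def_x]]]].
rewrite -[x](subrK h) def_x tauD -[RHS]add0r; congr +%R.
elim/big_rec: _ => // i u _ tau_u.
rewrite tauD tauZ tau_u addr0 -scaleN1r tauD tauZ tauC mulN1r subrr mulr0 //.
Qed.

Lemma cocentre_class_refl (h : H) : cocentre_class h h.
Proof.
exists 0%N, (fun=> 0), (fun=> 0), (fun=> 0); by rewrite subrr big_ord0.
Qed.

Lemma phi_cocentre O U w : minlen S (val U) w ->
  phi leS T O @` cocentre_class (T w) = [set (O == U)%:R].
Proof.
move=> min_w; rewrite -(phi_minlen O min_w); apply/seteqP; split=> [_ [x wx <-]|_ ->].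
  exact: trace_cocentre (phi_trace O) wx.
by exists (T w) => //; apply: cocentre_class_refl.
Qed.

Lemma phi_finite_support h : exists A : {fset conj_classes W},
  forall O, O \notin A -> phi leS T O h = 0.
Proof.
elim/(basis_ind basT): h => [w||k x y [A A0] [B B0]].
- have [n le_wn] := ubnP (len S w); elim: n => // n IH in w le_wn *.
  have [red_w|nred] := pselect (cyc_reduced S w).
    have [U min_w] := reduced_minlen red_w; exists [fset U]%fset => O.
    by rewrite inE (phi_minlen _ min_w) => /negbTE ->.
  have [s0 Sw] := cyc_reducedPn nred; have [lS lS2] := len_shortens cox ra Sw.
  have [|A A0] := IH (val s0 * w)%g; first by rewrite -lS in le_wn; lia.
  have [|B B0] := IH (val s0 * w * val s0)%g; first by rewrite -lS2 in le_wn; lia.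
  exists (A `|` B)%fset => O; rewrite inE negb_or => /andP[/A0 Aw /B0 Bw].
  have := trace_shortening_rule (phi_trace O) Sw.
  by rewrite /shortening_rule /= Aw Bw !mulr0 addr0.
- exists fset0 => O _; by have [-> _ _] := scalar_props (phi_scalar O).
exists (A `|` B)%fset => O; rewrite inE negb_or => /andP[/A0 Ax /B0 By].
by rewrite phi_scalar Ax By mulr0 addr0.
Qed.

(** * The isomorphism with functions on conjugacy classes *)

Implicit Types c : conj_classes W -> R^o.

Lemma phi_sumE c h (A : {fset conj_classes W}) :
  (forall O, O \notin A -> phi leS T O h = 0) ->
  phi_sum leS T c h = \sum_(O <- A) c O * phi leS T O h.
Proof. by move=> A0; apply: fsbigTE => O /A0 ->; rewrite mulr0. Qed.

Lemma phi_sum_linear : linear (phi_sum leS T).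
Proof.
move=> k c d; apply/funext => h; have [A A0] := phi_finite_support h.
rewrite -[RHS]/(k * phi_sum leS T c h + phi_sum leS T d h) !(phi_sumE _ A0).
rewrite mulr_sumr -big_split; apply: eq_bigr => O _ /=.
by rewrite -[(k *: c + d) O]/(k * c O + d O) mulrDl mulrA.
Qed.

Lemma phi_sum_trace c : is_trace (phi_sum leS T c).
Proof.
split=> [k x y|x y].
  have [A A0] := phi_finite_support x; have [B B0] := phi_finite_support y.
  have A0' O : O \notin (A `|` B)%fset -> phi leS T O x = 0.
    by rewrite inE negb_or => /andP[/A0].
  have B0' O : O \notin (A `|` B)%fset -> phi leS T O y = 0.
    by rewrite inE negb_or => /andP[_ /B0].
  rewrite (phi_sumE _ A0') (phi_sumE _ B0') (@phi_sumE _ _ (A `|` B)%fset); last first.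
    by move=> O notAB; rewrite phi_scalar A0' ?B0' // mulr0 addr0.
  rewrite mulr_sumr -big_split; apply: eq_bigr => O _ /=.
  by rewrite phi_scalar mulrDr mulrCA.
apply: eq_fsbigr => O _; by have [_ ->] := phi_trace O.
Qed.

Lemma phi_sum_minlen c O w : minlen S (val O) w -> phi_sum leS T c (T w) = c O.
Proof.
move=> min_w; rewrite (@phi_sumE _ _ [fset O]%fset) => [|U].
  by rewrite big_seq_fset1 (phi_minlen _ min_w) eqxx mulr1.
by rewrite inE (phi_minlen _ min_w) => /negbTE ->.
Qed.

Lemma ex_minlen O : exists w, minlen S (val O) w.
Proof.
have [y Oy] := conj_classP O.
pose Q n := `[< exists2 x, val O x & len S x = n >].
have exQ : exists n, Q n.
  by exists (len S y); apply/asboolP; exists y; rewrite // Oy; exists 1%g; rewrite ?conjg1.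
case: (ex_minnP exQ) => n /asboolP[x Ox len_x] min_n; exists x; split=> // z Oz.
by rewrite len_x; apply: min_n; apply/asboolP; exists z.
Qed.

(** Two elements of minimal length in a class are linked by length-preserving
conjugations by generators, which do not change the value of a trace. *)
Lemma trace_minlen (tau : H -> R) O w x : is_trace tau ->
  minlen S (val O) w -> minlen S (val O) x -> tau (T x) = tau (T w).
Proof.
move=> tr min_w min_x.
have conj_wx : conj_class w x.
  have [[[y Oy] [Ow _]] [Ox _]] := (conj_classP O, min_w, min_x).
  move: Ow Ox; rewrite Oy => -[h _ <-] [k _ <-].
  by exists (h^-1 * k)%g; rewrite // conjgM conjgK.
apply: (cyc_reduced_conj cox ra (P := fun y => tau (T y) = tau (T w))
  _ (minlen_reduced min_w) (minlen_reduced min_x) conj_wx) => //.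
by move=> s y eq_len <-; apply: (trace_shift_invariant tr).
Qed.

Lemma trace_eq (tau tau' : H -> R) : is_trace tau -> is_trace tau' ->
  (forall w, cyc_reduced S w -> tau (T w) = tau' (T w)) -> tau = tau'.
Proof.
move=> tr tr' eq_red; apply/funext.
have [[lin _] [lin' _]] := (tr, tr').
apply: (@linear_basis_eq _ _ _ _ basT R^o) => // w.
have [n le_wn] := ubnP (len S w); elim: n => // n IH in w le_wn *.
have [/eq_red //|/cyc_reducedPn[s Sw]] := pselect (cyc_reduced S w).
have [lS lS2] := len_shortens cox ra Sw.
have := trace_shortening_rule tr Sw; have := trace_shortening_rule tr' Sw.
rewrite /shortening_rule /= => -> ->; congr (_ * _ + _ * _); apply: IH.
  by rewrite -ltnS lS.
by rewrite -ltnS; apply: leq_trans le_wn; rewrite -lS2.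
Qed.

Lemma phi_sum_bij :
  set_bij [set: conj_classes W -> R^o] [set tau | is_trace tau] (phi_sum leS T).
Proof.
split=> [c _|c d _ _ eq_cd|tau tr].
- exact: phi_sum_trace.
- apply/funext => O; have [w min_w] := ex_minlen O.
  by rewrite -(phi_sum_minlen c min_w) eq_cd (phi_sum_minlen _ min_w).
have [w min_w] := choice ex_minlen; exists (tau \o T \o w) => //.
apply: trace_eq => // [|x /reduced_minlen[O min_x]]; first exact: phi_sum_trace.
by rewrite (phi_sum_minlen _ min_x) /=; apply: trace_minlen (min_w O).
Qed.

End Hecke.

Theorem theorem6p11 (W : groupType) (S : {fset W}) (leS : rel S) :
  coxeter_system S -> right_angled S -> total_order leS ->
  (forall (R : comNzRingType) (a b : S -> R) (H : algType R) (T : W -> H),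
     is_hecke a b T ->
     (forall O : conj_classes W, is_trace (phi leS T O)) /\
     (forall (O U : conj_classes W) (w : W), minlen S (val U) w ->
        phi leS T O @` cocentre_class (T w) = [set (O == U)%:R])) /\
  (forall (K : realType) (a b : S -> K[i]) (H : algType K[i]) (T : W -> H),
     is_hecke a b T ->
     [/\ forall h : H, finite_set [set O | phi leS T O h != 0],
         linear (phi_sum leS T)
       & set_bij [set: conj_classes W -> K[i]^o] [set tau | is_trace tau]
           (phi_sum leS T)]).
Proof.
move=> cox ra leS_order; split=> [R a b H T heckeH|K a b H T heckeH].
  split=> [O|O U w min_w]; first exact: (phi_trace cox ra heckeH leS_order).
  exact: (phi_cocentre cox ra heckeH leS_order).
split; first last.
- exact: (phi_sum_bij cox ra heckeH leS_order).
- exact: (phi_sum_linear cox ra heckeH leS_order).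
move=> h; have [A A0] := phi_finite_support cox ra heckeH leS_order h.
apply: (@sub_finite_set _ _ [set` A]); last exact: finite_fset.
by move=> O /=; apply: contraNT => /A0 ->.
Qed.
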